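(* Let $n\geq 2$ be a positive integer. Then $$\det(\mathrm{rcir}(\boldsymbol{c}_n(-1)))=0.$$
   Context: For $\boldsymbol{a}=(a_0,a_1,\dots,a_{n-1})\in\mathbb{C}^n$, $\mathrm{rcir}(\boldsymbol{a})$ denotes the $n\times n$ complex right circulant matrix with first row $\boldsymbol{a}$, each subsequent row being the preceding row rotated one position to the right; i.e., indexing rows and columns by $0,\dots,n-1$, its $(j,k)$ entry is $a_{(k-j)\bmod n}$. For a nonzero complex number $z$, $\boldsymbol{c}_n(z)=\left(\binom{n-1}{0}z^0,\binom{n-1}{1}z^1,\dots,\binom{n-1}{n-1}z^{n-1}\right)\in\mathbb{C}^n$ is the vector of coefficients of $(x+zy)^{n-1}$. *)

(* Defs.v *)
From mathcomp Require Import all_boot all_order all_algebra.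
From mathcomp Require Import reals complex.

Set Implicit Arguments.
Unset Strict Implicit.
Unset Printing Implicit Defensive.

Import GRing.Theory.

Local Open Scope ring_scope.

Definition ord_gt0 (n : nat) (i : 'I_n) : (0 < n)%N :=
  leq_ltn_trans (leq0n i) (ltn_ord i).

(* (k - j) mod n; n is added before subtracting because subn truncates at 0. *)
Definition ord_subm (n : nat) (k j : 'I_n) : 'I_n :=
  Ordinal (ltn_pmod (k + n - j)%N (ord_gt0 k)).

Definition rcir (K : Type) (n : nat) (a : 'rV[K]_n) : 'M[K]_n :=
  \matrix_(j < n, k < n) a 0 (ord_subm k j).

Definition binom_row (K : pzRingType) (n : nat) (z : K) : 'rV[K]_n :=
  \row_(k < n) ('C(n.-1, k)%:R * z ^+ k).

(* Main.v *)
Require Import Defs.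
From mathcomp Require Import all_boot all_order all_algebra.
From mathcomp Require Import reals complex.

Set Implicit Arguments.
Unset Strict Implicit.
Unset Printing Implicit Defensive.

Import GRing.Theory.

Local Open Scope ring_scope.

(** Every column of [rcir a] contains each entry of [a] once, so the all-ones row vector is a left
    eigenvector with eigenvalue the sum of [a] ([col_sum_rcir]); if that sum is 0, the matrix is
    singular ([det_rcir_sum0]). By the binomial theorem the sum here is [(1 + z) ^+ n.-1], which
    vanishes at [z = -1]. *)

Lemma ord_submK (n : nat) (k : 'I_n) : involutive (ord_subm k).
Proof.
move=> j; apply: val_inj => /=.
have [ltkn ltjn] := (ltn_ord k, ltn_ord j).
(* The reduction mod [n] removes one [n] when [j <= k], and does nothing when [k < j], as then
   [k + n - j < n]. *)
have [lejk | ltkj] := leqP j k.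
  have -> : ((k + n - j) %% n = k - j)%N.
    by rewrite -addnBAC // modnDr modn_small // (leq_ltn_trans (leq_subr _ _)).
  by rewrite -addnBAC ?leq_subr // subKn // modnDr modn_small.
have le_jkn : (j <= k + n)%N by rewrite (leq_trans (ltnW ltjn)) ?leq_addl.
rewrite (@modn_small (k + n - j)) ?subKn ?modn_small //.
by rewrite ltn_subLR // ltn_add2r.
Qed.

Lemma col_sum_rcir (K : pzRingType) (n : nat) (a : 'rV[K]_n) (k : 'I_n) :
  \sum_j rcir a j k = \sum_j a 0 j.
Proof.
rewrite [RHS](reindex_inj (inv_inj (ord_submK k))).
by apply: eq_bigr => j _; rewrite mxE.
Qed.

Lemma det_rcir_sum0 (K : idomainType) (n : nat) (a : 'rV[K]_n) :
  (0 < n)%N -> \sum_j a 0 j = 0 -> \det (rcir a) = 0.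
Proof.
(* The all-ones row is the left kernel vector; it is nonzero because [n > 0]. *)
move=> n_gt0 sum_a0; apply/eqP/det0P; exists (const_mx 1).
  apply/eqP => /rowP/(_ (Ordinal n_gt0)); rewrite !mxE.
  by apply/eqP/oner_neq0.
apply/rowP => k; rewrite !mxE -[RHS]sum_a0 -(col_sum_rcir a k).
by apply: eq_bigr => j _; rewrite [const_mx _ _ _]mxE mul1r.
Qed.

Lemma sum_binom_row (K : comPzRingType) (n : nat) (z : K) :
  (0 < n)%N -> \sum_j binom_row n z 0 j = (1 + z) ^+ n.-1.
Proof.
case: n => // n _; rewrite exprDn; apply: eq_bigr => j _.
by rewrite mxE expr1n mul1r mulr_natl.
Qed.

Theorem proposition3p3 (R : realType) (n : nat) (hn : (2 <= n)%N) :
  \det (rcir (binom_row n (-1 : R[i]))) = 0.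
Proof.
have n_gt0 : (0 < n)%N := ltnW hn.
apply: det_rcir_sum0 => //; rewrite sum_binom_row // subrr expr0n.
(* What remains is [0 ^+ n.-1], rewritten as a Boolean test of [n.-1 == 0]; [2 <= n] excludes the
   case [0 ^+ 0 = 1]. *)
by case: n hn {n_gt0} => [|[]].
Qed.
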